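(* Let $X$ be an uncountable regular open Whyburn space. The following are equivalent: (1) $X$ satisfies $S_{fin}(\Omega^s,\Omega^s)$; (2) $X$ satisfies $S_{fin}(\mathcal{K}_{\Omega},\mathcal{K}_{\Omega})$; (3) $vet(\mathbf{0},Q_p(X,\mathbb{R}))=\omega$; (4) $vet(f,Q_p(X,\mathbb{R}))=\omega$ for every continuous $f:X\to\mathbb{R}$; (5) $vet(Q_p(X,\mathbb{D}))=\omega$.
   Context: All spaces are assumed regular. A function $f:X\to Y$ is quasicontinuous if for every $x\in X$, every open $V\ni f(x)$ and every open $U\ni x$ there is a nonempty open $W\subseteq U$ with $f(W)\subseteq V$. $Q_p(X,Y)$ is the set of all quasicontinuous functions $X\to Y$ with the topology of pointwise convergence; $\mathbb{D}=\{0,1\}$ is discrete; $\mathbf{0}$ is the constant zero function. $X$ is open Whyburn if for every open $A\subseteq X$ and every $x\in\overline{A}\setminus A$ there is an open $B\subseteq A$ with $\overline{B}\setminus A=\{x\}$. A set $A$ is minimally bounded if $A\subseteq\overline{\mathrm{Int}A}$ and $\mathrm{Int}\overline{A}\subseteq A$. $\Omega^s$ is the collection of covers of $X$ by minimally bounded sets which are $\omega$-covers (every finite subset of $X$ lies in some member). $\mathcal{K}_\Omega$ is the set of families $\mathcal{U}$ of open subsets of $X$ with $X=\bigcup\{\overline{U}:U\in\mathcal{U}\}$, no element of $\mathcal{U}$ dense in $X$, and for each finite $F\subseteq X$ some $U\in\mathcal{U}$ with $F\subseteq\overline{U}$. $S_{fin}(\mathcal{A},\mathcal{B})$: for every sequence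 $(A_n)_{n\in\mathbb{N}}$ of elements of $\mathcal{A}$ there are finite $B_n\subseteq A_n$ with $\bigcup_n B_n\in\mathcal{B}$. For a space $Z$ and $z\in Z$, $vet(z,Z)=\omega$ means: for every sequence $(A_n)_{n\in\omega}$ of subsets of $Z$ with $z\in\bigcap_n\overline{A_n}$ there are finite $K_n\subseteq A_n$ with $z\in\overline{\bigcup_n K_n}$; $vet(Z)=\omega$ means this holds for all $z\in Z$. *)

(* Defs.v *)
From HB Require Import structures.
From mathcomp Require Import all_boot all_order all_algebra.
From mathcomp Require Import all_classical all_reals all_analysis.
Set Implicit Arguments. Unset Strict Implicit. Unset Printing Implicit Defensive.
Import Order.TTheory GRing.Theory Num.Theory.
Local Open Scope classical_set_scope.
Local Open Scope ring_scope.

Definition quasicontinuous {X Y : topologicalType} (f : X -> Y) : Prop :=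
  forall (x : X) (V : set Y) (U : set X), open V -> V (f x) -> open U -> U x ->
    exists W : set X, [/\ open W, W !=set0, W `<=` U & f @` W `<=` V].

(** Q_p(X,Y): quasicontinuous functions, with the subspace topology
    inherited from the topology of pointwise convergence {ptws X -> Y}. *)
Definition Qp (X Y : topologicalType) : topologicalType :=
  set_type (@quasicontinuous X Y : set {ptws X -> Y}).

Definition open_Whyburn (X : topologicalType) : Prop :=
  forall (A : set X) (x : X), open A -> closure A x -> ~ A x ->
    exists B : set X, [/\ open B, B `<=` A & closure B `\` A = [set x]].

Definition minimally_bounded {X : topologicalType} (A : set X) : Prop :=
  A `<=` closure (interior A) /\ interior (closure A) `<=` A.

Definition OmegaS (X : topologicalType) (C : set (set X)) : Prop :=
  [/\ \bigcup_(A in C) A = [set: X],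
      (forall A, C A -> minimally_bounded A) &
      (forall F : set X, finite_set F -> exists2 A, C A & F `<=` A)].

Definition KOmega (X : topologicalType) (U : set (set X)) : Prop :=
  [/\ (forall V, U V -> open V),
      \bigcup_(V in U) closure V = [set: X],
      (forall V, U V -> closure V <> [set: X]) &
      (forall F : set X, finite_set F -> exists2 V, U V & F `<=` closure V)].

Definition S_fin {X : Type} (A B : set (set X) -> Prop) : Prop :=
  forall An : nat -> set (set X), (forall n, A (An n)) ->
    exists Bn : nat -> set (set X),
      (forall n, finite_set (Bn n) /\ Bn n `<=` An n) /\ B (\bigcup_n Bn n).

Definition vet_omega_at {Z : topologicalType} (z : Z) : Prop :=
  forall A : nat -> set Z, (forall n, closure (A n) z) ->
    exists K : nat -> set Z,
      (forall n, finite_set (K n) /\ K n `<=` A n) /\ closure (\bigcup_n K n) z.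

Definition vet_omega (Z : topologicalType) : Prop :=
  forall z : Z, vet_omega_at z.

(* Main.v *)
Require Import Defs.
From HB Require Import structures.
From mathcomp Require Import all_boot all_order all_algebra.
From mathcomp Require Import all_classical all_reals all_analysis.
From mathcomp Require Import ring.
Import Order.TTheory GRing.Theory Num.Theory.
Import numFieldNormedType.Exports.
Local Open Scope classical_set_scope.
Local Open Scope ring_scope.

(* By the open Whyburn property and regularity, for every finite subset [F] of the closure
   of an open set [E] there is an open [B `<=` E] with [F `<=` closure B `<=` E `|` F].
   Covers by quasi-open sets can therefore be refined to families of open sets whose
   closures still cover, and all five conditions reduce to [S_fin KOmega KOmega].

   The delicate case is a discontinuous [f : X -> bool], since [{f = g}] may have empty
   interior. Let [Y0], [Y1] be the interiors of the fibres of [f] and [N] the complement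
   of [Y0 `|` Y1]. The selection principle makes [N] countable and [Y1] a countable union of
   open sets [G k] with [closure (G k) `<=` Y1]. Agreement of [g] with [f] is imposed
   outright on more and more points of [N]; away from [N], where [f] is continuous, one
   selects from open sets [W `|` (Y1 `\` closure (G k))] with [closure W `<=` {f = g}]:
   their closures contain [N], and within [Y0 `|` G k] they lie in [{f = g}]. *)

(** * Shrinking open sets around finite sets *)

Lemma closure_finite_bigcup {X : topologicalType} {I : choiceType} (A : set I)
    (F : I -> set X) :
  finite_set A ->
  closure (\bigcup_(i in A) F i) `<=` \bigcup_(i in A) closure (F i).
Proof.
move=> finA.
have /closure_id -> : closed (\bigcup_(i in A) closure (F i)).
  by apply: closed_bigcup => // i _; exact: closed_closure.
by apply: closureS => x [i Ai Fx]; exists i => //; exact: subset_closure.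
Qed.

Lemma open_closure_meets {X : topologicalType} (A B : set X) (x : X) :
  open A -> A x -> closure B x -> exists2 y, A y & B y.
Proof.
move=> oA Ax /(_ A (open_nbhs_nbhs (conj oA Ax))) [y [By Ay]].
by exists y.
Qed.

Lemma regular_open_nbhs {X : topologicalType} (E : set X) (x : X) :
  regular_space X -> open E -> E x ->
  exists B, [/\ open B, B x & closure B `<=` E].
Proof.
move=> regX oE Ex; have [V nV VE] := regX x E (open_nbhs_nbhs (conj oE Ex)).
exists V°; split.
- exact: open_interior.
- exact: nV.
- by apply: subset_trans VE; apply: closureS; exact: interior_subset.
Qed.

(** Regularity handles the points of [F] in [E], the open Whyburn property those outside. As [F] is
    finite, taking the union of the pieces adds no further closure points. *)
Lemma open_Whyburn_shrink {X : topologicalType} (E F : set X) :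
  regular_space X -> open_Whyburn X ->
  open E -> finite_set F -> F `<=` closure E ->
  exists B, [/\ open B, B `<=` E, F `<=` closure B & closure B `<=` E `|` F].
Proof.
move=> regX owX oE finF FE.
have shrink1 x : exists B, F x ->
    [/\ open B, B `<=` E, closure B x & closure B `<=` E `|` [set x]].
  have [Fx|nFx] := pselect (F x); last by exists set0.
  have [Ex|nEx] := pselect (E x).
    have [B [oB Bx BE]] := regular_open_nbhs E x regX oE Ex.
    exists B => _; split => //.
    - exact: subset_trans (@subset_closure _ B) BE.
    - exact: subset_closure.
    - by move=> y /BE; left.
  have [B [oB BE clB]] := owX E x oE (FE x Fx) nEx.
  exists B => _; split => //.
    by have : [set x] x by []; rewrite -clB => -[].
  move=> y By; have [Ey|nEy] := pselect (E y); [by left | right].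
  by rewrite -clB.
have [B BP] := choice shrink1.
exists (\bigcup_(x in F) B x); split.
- by apply: bigcup_open => x /BP[].
- by move=> y [x /BP[_ + _ _]]; apply.
- move=> x Fx; have [_ _ + _] := BP x Fx.
  by apply: closureS => y By; exists x.
- move=> y /(closure_finite_bigcup _ _ finF) [x Fx].
  have [_ _ _ BE] := BP x Fx.
  by move=> /BE [|->]; [left | right].
Qed.

(** * Selection and exhaustion from [S_fin KOmega KOmega] *)

Lemma finite_set_lift {S T : Type} (A : set S) (B : set T)
    (R : S -> T -> Prop) :
  finite_set B -> (forall t, B t -> exists2 s, A s & R s t) ->
  exists K, [/\ finite_set K, K `<=` A & forall t, B t -> exists2 s, K s & R s t].
Proof.
move=> finB AR.
have [[s0 _]|noS] := pselect (exists s : S, True); last first.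
  exists set0; split => // t /AR [s _ _].
  by case: noS; exists s.
have /choice [h hP] : forall t, exists s, B t -> A s /\ R s t.
  by move=> t; have [/AR [s]|] := pselect (B t); [exists s | exists s0].
exists (h @` B); split; first exact: finite_image.
- by move=> _ [t /hP [? _] <-].
- by move=> t Bt; exists (h t); [exists t | have [] := hP t Bt].
Qed.

(** Selects objects [g] through the open sets [U] that witness them. The bound [m <= n] is obtained
    by treating every tail of the sequence separately. *)
Lemma S_fin_KOmega_select {X : topologicalType} {T : Type} (A : nat -> set T)
    (R : nat -> T -> set X -> Prop) :
  S_fin (@KOmega X) (@KOmega X) ->
  (forall n F, finite_set F ->
    exists g U, [/\ A n g, R n g U, open U & F `<=` closure U]) ->
  exists K : nat -> set T, (forall n, finite_set (K n) /\ K n `<=` A n) /\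
    forall m F, finite_set F ->
      exists n g U, [/\ (m <= n)%N, K n g, R n g U & F `<=` closure U].
Proof.
move=> selX AR.
have tail m : exists K : nat -> set T,
    (forall n, finite_set (K n) /\ K n `<=` A n) /\ forall F, finite_set F ->
      exists n g U, [/\ (m <= n)%N, K n g, R n g U & F `<=` closure U].
  (* [KOmega] forbids dense members, so a dense [U] is treated apart: its single [g] serves every
     [F]. *)
  have [[n [g [U [mn Ag RU denseU]]]]|ndense] := pselect (exists n g U,
      [/\ (m <= n)%N, A n g, R n g U & closure U = [set: X]]).
    exists (fun i => [set h | i = n /\ h = g]); split => [i|F _].
      split; last by move=> h [-> ->].
      by apply: (sub_finite_set _ (finite_set1 g)) => h [].
    by exists n, g, U; rewrite denseU.
  pose Un n := [set U | open U /\ exists2 g, A (m + n)%N g & R (m + n)%N g U].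
  have UnK n : KOmega (Un n).
    split.
    - by move=> V [].
    - apply/seteqP; split => // x _.
      have [g [U [Ag RU oU FU]]] := AR (m + n)%N [set x] (finite_set1 x).
      by exists U; [split => //; exists g | exact: FU].
    - move=> V [_ [g Ag RV]] denseV; apply: ndense.
      by exists (m + n)%N, g, V; rewrite leq_addr.
    - move=> F finF; have [g [U [Ag RU oU FU]]] := AR (m + n)%N F finF.
      by exists U => //; split => //; exists g.
  have [Bn [BnU [_ _ _ Bcov]]] := selX Un UnK.
  have /choice [K KP] n : exists K, [/\ finite_set K, K `<=` A (m + n)%N &
      forall U, Bn n U -> exists2 g, K g & R (m + n)%N g U].
    have [finB BU] := BnU n.
    by apply: finite_set_lift => // U /BU [_].
  exists (fun i => [set g | (m <= i)%N /\ K (i - m)%N g]); split => [i|F finF].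
    have [finK KA _] := KP (i - m)%N; split; last first.
      by move=> g [mi]; move=> /KA; rewrite subnKC.
    by apply: (sub_finite_set _ finK) => g [].
  have [V [n _ BV] FV] := Bcov F finF.
  have [_ _ /(_ V BV) [g Kg RV]] := KP n.
  exists (m + n)%N, g, V; split => //; first exact: leq_addr.
  by split; [exact: leq_addr | rewrite addKn].
have [K KP] := choice tail.
(* Tail [m] is only consulted at stages [n >= m], so stage [n] needs just the finitely many
   [m <= n]. *)
exists (fun n => \bigcup_(m in `I_n.+1) K m n); split => [n|m F finF].
  split; last by move=> g [m _ Kg]; have [/(_ n)[_ KA] _] := KP m; exact: KA.
  by apply: bigcup_finite => [|m _]; [exact: finite_II | have [/(_ n)[]] := KP m].
have [_ /(_ F finF) [n [g [U [mn Kg RU FU]]]]] := KP m.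
by exists n, g, U; split => //; exists m.
Qed.

(** One selects from the constant family [P] and joins everything chosen up to stage [n]. This
    serves for finite sets exhausting a nowhere dense set and for open sets exhausting the interior
    of a fibre. *)
Lemma S_fin_KOmega_exhaustion {X : topologicalType} (P : set (set X))
    (Z : set X) :
  S_fin (@KOmega X) (@KOmega X) ->
  P set0 -> (forall S S', P S -> P S' -> P (S `|` S')) ->
  (forall F, finite_set F -> exists S U,
    [/\ P S, open U, F `<=` closure U & closure U `&` Z `<=` S]) ->
  exists S_ : nat -> set X, [/\ forall n, P (S_ n),
    forall m n, (m <= n)%N -> S_ m `<=` S_ n &
    forall F, finite_set F -> exists n, F `&` Z `<=` S_ n].
Proof.
move=> selX P0 PU PF.
have [|K [KP Kcov]] := @S_fin_KOmega_select X (set X) (fun=> P)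
    (fun _ S U => closure U `&` Z `<=` S) selX.
  by move=> _ F /PF [S [U [PS oU FU US]]]; exists S, U.
have PK n : P (\bigcup_(S in K n) S).
  have [/finite_setP [k]] := KP n.
  elim: k (K n) => [|k IH] D.
    by rewrite II0 card_eq0 => /eqP -> _; rewrite bigcup_set0.
  move=> /eq_cardSP [S DS Dk] DP.
  rewrite (bigcup_setD1 S) //; apply: PU; first exact: DP.
  by apply: IH => // S' [/DP].
exists (fun n => \bigcup_(i in `I_n.+1) \bigcup_(S in K i) S); split.
- elim=> [|n IH]; first by rewrite II1 bigcup_set1; exact: PK.
  by rewrite IIS bigcup_setU bigcup_set1; apply: PU.
- by move=> m n mn x [i im Kx]; exists i => //=; exact: leq_trans im _.
- move=> F finF; have [n [S [U [_ KS US FU]]]] := Kcov 0%N F finF.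
  exists n => x [Fx Zx]; exists n => //=; exists S => //.
  by apply: US; split => //; exact: FU.
Qed.

(** * Pointwise neighbourhoods and quasicontinuous indicators *)

Lemma closure_QpP {X Y : topologicalType} (A : set (Qp X Y)) (z : Qp X Y) :
  closure A z <-> forall (F : set X) (V : X -> set Y), finite_set F ->
    (forall x, F x -> nbhs (set_val z x) (V x)) ->
    exists2 g : Qp X Y, A g & forall x, F x -> V x (set_val g x).
Proof.
split=> [Az F V /finite_fsetP [D FD] nV|AP B].
  have ev_nbhs x : F x ->
      nbhs z [set g : Qp X Y | V x (set_val g x)].
    move=> /nV zV.
    apply: (@initial_continuous (Qp X Y) {ptws X -> Y} set_val z
      [set h | V x (h x)]).
    exact: (@proj_continuous X (fun=> Y) x (set_val z) (V x) zV).
  have /Az [g [Ag gV]] : nbhs z (\bigcap_(x in F)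
      [set g : Qp X Y | V x (set_val g x)]).
    by rewrite FD; apply: filter_bigI => x xD; apply: ev_nbhs; rewrite FD.
  by exists g => // x; exact: gV.
move=> [_ [[C oC <-] /= Cz] CB].
pose G : set_system {ptws X -> Y} := filter_from
  [set FV : set X * (X -> set Y) | finite_set FV.1 /\
     forall x, FV.1 x -> nbhs (set_val z x) (FV.2 x)]
  (fun FV => [set g | forall x, FV.1 x -> FV.2 x (g x)]).
have GF : Filter G.
  apply: filter_from_filter; first by exists (set0, fun=> setT).
  move=> [F V] [F' V'] /= [finF nV] [finF' nV'].
  exists (F `|` F', fun x => [set y | (F x -> V x y) /\ (F' x -> V' x y)]).
    split=> /= [|x _]; first by rewrite finite_setU.
    apply: filterI.
      have [Fx|nFx] := pselect (F x); last exact: filterS filterT.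
      by apply: filterS (nV x Fx) => y.
    have [Fx|nFx] := pselect (F' x); last exact: filterS filterT.
    by apply: filterS (nV' x Fx) => y.
  move=> g /= gP; split => x Fx; first by have [+ _] := gP x (or_introl Fx); apply.
  by have [_ +] := gP x (or_intror Fx); apply.
(* The pointwise topology is a supremum of initial topologies, so convergence of the filter [G] of
   basic neighbourhoods is checked one coordinate at a time. *)
have Gz : G --> (set_val z : {ptws X -> Y}).
  apply/cvg_sup => x D [_ [[D' oD' <-] /= D'z] D'D].
  exists ([set x], fun=> D').
    split=> /= [|y ->]; first exact: finite_set1.
    exact: open_nbhs_nbhs.
  by move=> g /= gP; apply: D'D; exact: gP.
have [[F V] /= [finF nV] FVC] : G C.
  by apply: Gz; exact: open_nbhs_nbhs.
have [g Ag gV] := AP F V finF nV.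
by exists g; split => //; apply: CB; exact: FVC.
Qed.

(** The first half of minimal boundedness serves the points of [A]; the second puts every point off
    [A] in the closure of the complement of [closure A]. *)
Lemma quasicontinuous_indicator {X Y : topologicalType} (A : set X)
    (y0 y1 : Y) :
  minimally_bounded A ->
  quasicontinuous (fun x => if x \in A then y0 else y1).
Proof.
move=> [Aint intA] x V U oV Vfx oU Ux.
have [xA|xA] := boolP (x \in A).
  have /set_mem/Aint /(open_closure_meets _ _ _ oU Ux) [y Uy Ay] := xA.
  exists (A° `&` U); split.
  - by apply: openI => //; exact: open_interior.
  - by exists y.
  - by move=> ? [].
  - move=> _ [w [/interior_subset Aw _] <-].
    by rewrite mem_set //; rewrite xA in Vfx.
have nAx : closure (~` closure A) x.
  by rewrite closure_setC => /intA /mem_set; apply/negP.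
have [y Uy Ay] := open_closure_meets _ _ _ oU Ux nAx.
exists (~` closure A `&` U); split.
- by apply: openI => //; exact/closed_openC/closed_closure.
- by exists y.
- by move=> ? [].
- move=> _ [w [nAw _] <-]; rewrite memNset; last by move/subset_closure.
  by rewrite (negbTE xA) in Vfx.
Qed.

(** * From tightness at a constant function to selection principles *)

Lemma vet_omega_cst_S_fin_OmegaS {X Y : topologicalType} (y0 y1 : Y)
    (V : set Y) :
  nbhs y0 V -> ~ V y1 ->
  (forall z : Qp X Y, (set_val z : X -> Y) = cst y0 -> vet_omega_at z) ->
  S_fin (@OmegaS X) (@OmegaS X).
Proof.
move=> nV Vy1 vetX C CO.
have cst_quasi : @quasicontinuous X Y (cst y0).
  by move=> x V' U _ V'x oU Ux; exists U; split => //; [exists x | move=> _ [? _ <-]].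
pose z : Qp X Y := exist _ (cst y0 : {ptws X -> Y}) (mem_set cst_quasi).
pose ind (A : set X) x := if x \in A then y0 else y1.
pose D n := [set g : Qp X Y | exists2 A, C n A & (set_val g : X -> Y) = ind A].
(* [D n] accumulates at [z] because [C n] is an omega-cover. *)
have [n|K [KD Kz]] := vetX z erefl D.
  apply/closure_QpP => F W finF nW.
  have [_ /(_ _ _) mbC /(_ F finF) [A CA FA]] := CO n.
  exists (exist _ (ind A : {ptws X -> Y})
      (mem_set (quasicontinuous_indicator A y0 y1 (mbC A CA)))); first by exists A.
  move=> x Fx; rewrite -[set_val _ x]/(ind A x) /ind mem_set; last exact: FA.
  exact: nbhs_singleton (nW x Fx).
have /choice [B BP] n : exists B, [/\ finite_set B, B `<=` C n &
    forall g, K n g -> exists2 A, B A & (set_val g : X -> Y) = ind A].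
  have [finK KDn] := KD n.
  by apply: finite_set_lift => // g /KDn [A]; exists A.
exists B; split=> [n|]; first by have [] := BP n.
(* Since [V] excludes [y1], an [ind A] with values in [V] on [F] forces [F] into [A]. *)
have Bcov F : finite_set F -> exists2 A, (\bigcup_n B n) A & F `<=` A.
  move=> finF; move/closure_QpP : Kz => /(_ F (fun=> V) finF) [//|g [n _ Kg] gV].
  have [_ _ /(_ g Kg) [A BA gA]] := BP n.
  exists A; first by exists n.
  move=> x /gV; rewrite gA /ind; case: ifPn => [/set_mem //|_].
  by move/Vy1.
split => //.
- apply/seteqP; split => // x _.
  by have [A ? xA] := Bcov [set x] (finite_set1 x); exists A => //; exact: xA.
- move=> A [n _ BA]; have [_ + _] := CO n; apply.
  by have [_ + _] := BP n; apply.
Qed.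

(** Closures of open sets are minimally bounded, so passing to closures turns a [KOmega] family into
    an [OmegaS] cover; the selected closures are then lifted back to members of the family. *)
Lemma S_fin_OmegaS_KOmega {X : topologicalType} :
  S_fin (@OmegaS X) (@OmegaS X) -> S_fin (@KOmega X) (@KOmega X).
Proof.
move=> selX U UK.
have [n|B [BU [_ _ Bcov]]] := selX (fun n => closure @` U n).
  have [oU Ucov _ Ufin] := UK n; split.
  - by rewrite bigcup_image.
  - move=> _ [V /oU oV <-]; split.
      apply: closureS; rewrite -open_subsetE //; exact: subset_closure.
    rewrite -(proj1 (closure_id _) (@closed_closure _ V)).
    exact: interior_subset.
  - by move=> F /Ufin [V UV FV]; exists (closure V) => //; exists V.
have /choice [B' B'P] n : exists B', [/\ finite_set B', B' `<=` U n &
    forall A, B n A -> exists2 V, B' V & closure V = A].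
  have [finB BUn] := BU n.
  by apply: finite_set_lift => // A /BUn [V]; exists V.
exists B'; split=> [n|]; first by have [] := B'P n.
have B'cov F : finite_set F -> exists2 V, (\bigcup_n B' n) V & F `<=` closure V.
  move=> /Bcov [A [n _ BA] FA]; have [_ _ /(_ A BA) [V B'V VA]] := B'P n.
  by exists V; [exists n | rewrite VA].
split => //.
- move=> V [n _ B'V]; have [+ _ _ _] := UK n; apply.
  by have [_ + _] := B'P n; apply.
- apply/seteqP; split => // x _.
  by have [A ? xA] := B'cov [set x] (finite_set1 x); exists A => //; exact: xA.
- move=> V [n _ B'V]; have [_ _ + _] := UK n; apply.
  by have [_ + _] := B'P n; apply.
Qed.

(** * Approximation of continuous functions *)

Lemma quasicontinuous_closure_interior {X Y Z : topologicalType} (f : X -> Y)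
    (g : X -> Z) (D : set (Y * Z)) (x : X) :
  {for x, continuous f} -> quasicontinuous g -> nbhs (f x, g x) D ->
  closure [set y | D (f y, g y)]° x.
Proof.
move=> fx gq [[P Q] /= [nP nQ] PQD] B nB.
(* Continuity keeps [f] in [P] near [x], so the open set that quasicontinuity gives for [g] suits
   both functions. *)
have nU : nbhs x (B `&` f @^-1` P) by apply: filterI => //; exact: fx.
have [W [oW [w Ww] WU gW]] := gq x Q° (B `&` f @^-1` P)° (@open_interior _ Q) nQ
  (@open_interior _ _) nU.
exists w; split; last by have /interior_subset [] := WU w Ww.
apply: (filterS _ (open_nbhs_nbhs (conj oW Ww))) => y Wy.
apply: PQD; split => /=; first by have /interior_subset [] := WU y Wy.
by apply: interior_subset; apply: gW; exists y.
Qed.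

Lemma nbhs_dist_lt {R : realType} (a b e : R) :
  `|a - b| < e -> nbhs (a : R^o, b : R^o) [set yz | `|yz.1 - yz.2| < e].
Proof.
(* Both coordinates move, so each gets half of the slack. *)
move=> abe; pose d := (e - `|a - b|) / 2.
have d0 : 0 < d by rewrite divr_gt0 // subr_gt0.
exists (ball (a : R^o) d, ball (b : R^o) d).
  by split; exact: nbhsx_ballx.
move=> [y z] /= [ay bz].
have -> : y - z = (a - b) + ((b - z) - (a - y)) by ring.
apply: (le_lt_trans (ler_normD _ _)); rewrite -ltrBrDl.
apply: (le_lt_trans (ler_normB _ _)).
have -> : e - `|a - b| = d + d by rewrite /d; field.
exact: ltrD.
Qed.

(** Stage [n] demands precision [1/(n+1)]; selections beyond every [m] then approximate arbitrarily
    well on [F]. *)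
Lemma S_fin_KOmega_vet_continuous {R : realType} {X : topologicalType}
    (f : Qp X R^o) :
  regular_space X -> open_Whyburn X -> S_fin (@KOmega X) (@KOmega X) ->
  continuous (set_val f : X -> R^o) -> vet_omega_at f.
Proof.
move=> regX owX selX cf A fA.
have [n F finF|K [KA Kcov]] := S_fin_KOmega_select A (fun n (g : Qp X R^o) U =>
    forall x, closure U x -> `|set_val f x - set_val g x| < n.+1%:R^-1) selX.
  have /closure_QpP/(_ F (fun x => ball (set_val f x) n.+1%:R^-1) finF) := fA n.
  move=> [|g Ag fg]; first by move=> x _; apply: nbhsx_ballx.
  pose E := [set x | `|set_val f x - set_val g x| < n.+1%:R^-1].
  have FE : F `<=` closure E°.
    move=> x Fx; apply: (@quasicontinuous_closure_interior X R^o R^o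
      (set_val f) (set_val g) [set yz | `|yz.1 - yz.2| < n.+1%:R^-1] x).
    - exact: cf.
    - exact: (set_mem (valP g)).
    - by apply: nbhs_dist_lt; exact: fg.
  have [B [oB BE FB clB]] := open_Whyburn_shrink E° F regX owX
    (@open_interior _ E) finF FE.
  (* The points that [closure B] adds to the interior of [E] lie in [F], where [g] was chosen close
     to [f]. *)
  exists g, B; split => // x /clB [/interior_subset //|Fx].
  exact: fg.
exists K; split => //; apply/closure_QpP => F V finF nV.
have [m _ mV] : \forall n \near \oo, forall x, F x ->
    ball (set_val f x : R^o) n.+1%:R^-1 `<=` V x.
  have /finite_fsetP [D FD] := finF.
  have : \forall n \near \oo, (\bigcap_(x in F)
      [set n | ball (set_val f x : R^o) n.+1%:R^-1 `<=` V x]) n.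
    rewrite FD; apply: filter_bigI => x xD.
    have /nV /nbhs_ballP [e /= e0 eV] : F x by rewrite FD.
    apply: filterS (near_infty_natSinv_lt (PosNum e0)) => n /= ne.
    apply: subset_trans eV; exact/le_ball/ltW.
  by apply: filterS => n Fn x; exact: Fn.
have [n [g [U [mn Kg fg FU]]]] := Kcov m F finF.
exists g; first by exists n.
by move=> x Fx; apply: (mV n mn x Fx); exact/fg/FU.
Qed.

(** * Exhaustions and Boolean-valued functions *)

Lemma regular_finite_nbhs {X : topologicalType} (E F : set X) :
  regular_space X -> open E -> finite_set F -> F `<=` E ->
  exists G, [/\ open G, F `<=` G & closure G `<=` E].
Proof.
move=> regX oE finF FE.
have /choice [B BP] x : exists B, F x -> [/\ open B, B x & closure B `<=` E].
  have [/FE Ex|nFx] := pselect (F x); last by exists set0.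
  by have [B BP] := regular_open_nbhs E x regX oE Ex; exists B.
exists (\bigcup_(x in F) B x); split.
- by apply: bigcup_open => x /BP[].
- by move=> x Fx; exists x => //; have [] := BP x Fx.
- move=> y /(closure_finite_bigcup _ _ finF) [x /BP [_ _ BE]]; exact: BE.
Qed.

Section Exhaustion.
Context {X : topologicalType}.
Hypotheses (regX : regular_space X) (owX : open_Whyburn X)
  (selX : S_fin (@KOmega X) (@KOmega X)).

(** By density [F] lies in [closure E]; the shrunken open set has closure meeting the complement of
    [E] only inside [F]. In particular that complement is countable. *)
Lemma nowhere_dense_finite_exhaustion (E : set X) :
  open E -> closure E = [set: X] ->
  exists N : nat -> set X, [/\ forall n, finite_set (N n),
    forall m n, (m <= n)%N -> N m `<=` N n &
    forall F, finite_set F -> exists n, F `&` ~` E `<=` N n].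
Proof.
move=> oE denseE; apply: S_fin_KOmega_exhaustion => //.
- by move=> S S' finS finS'; rewrite finite_setU.
- move=> F finF.
  have [|B [oB BE FB clB]] := open_Whyburn_shrink E F regX owX oE finF.
    by rewrite denseE.
  by exists F, B; split => // x [/clB [|//]].
Qed.

Lemma regular_open_exhaustion (Y0 Y1 : set X) :
  open Y0 -> open Y1 -> Y0 `&` Y1 = set0 -> ~` (Y0 `|` Y1) `<=` closure Y0 ->
  exists G : nat -> set X, [/\ forall n, open (G n) /\ closure (G n) `<=` Y1,
    forall m n, (m <= n)%N -> G m `<=` G n &
    forall F, finite_set F -> exists n, F `&` Y1 `<=` G n].
Proof.
move=> oY0 oY1 disj bdY0.
apply: (@S_fin_KOmega_exhaustion X [set G | open G /\ closure G `<=` Y1]) => //.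
- by split; [exact: open0 | rewrite closure0].
- move=> S S' [oS SY] [oS' SY']; split; first exact: openU.
  by rewrite closureU => x [/SY|/SY'].
- move=> F finF.
  have finF1 : finite_set (F `&` Y1) by exact: finite_setIl.
  have [G [oG FG GY]] := regular_finite_nbhs Y1 (F `&` Y1) regX oY1 finF1
    (@subIsetr _ _ _).
  have [|B [oB BG FB clB]] := open_Whyburn_shrink G (F `&` Y1) regX owX oG finF1.
    exact: subset_trans FG (@subset_closure _ G).
  (* [Y0] brings the points of [F] off [Y1] into the closure, while [closure Y0] misses the open set
     [Y1]. *)
  exists G, (Y0 `|` B); split => //; first exact: openU.
  + rewrite closureU => x Fx.
    have [Y1x|nY1x] := pselect (Y1 x); first by right; exact: FB.
    left; have [Y0x|nY0x] := pselect (Y0 x); first exact: subset_closure.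
    by apply: bdY0 => -[].
  + rewrite closureU => x [[Y0x|/clB [//|/FG //]] Y1x].
    have [y Y1y Y0y] := open_closure_meets _ _ _ oY1 Y1x Y0x.
    by have : set0 y by rewrite -disj.
Qed.

Lemma S_fin_KOmega_vet_bool : vet_omega (Qp X bool).
Proof.
move=> f A fA.
pose v : X -> bool := set_val f.
have vq : quasicontinuous v := set_mem (valP f).
pose Y b := [set x | v x = b]°.
have oY b : open (Y b) by exact: open_interior.
have vY b x : Y b x -> v x = b by move/interior_subset.
(* The target is discrete, so quasicontinuity places each point in the closure of the interior of
   its own fibre. *)
have vclY x : closure (Y (v x)) x.
  move=> B nB.
  have [W [oW [w Ww] WB vW]] := vq x [set v x] B° (discrete_open _) erefl
    (@open_interior _ B) nB.
  exists w; split; last exact: interior_subset (WB w Ww).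
  apply: filterS (open_nbhs_nbhs (conj oW Ww)) => y Wy.
  by apply: vW; exists y.
pose E := Y true `|` Y false.
(* A point off [E] is not interior to its own fibre, so the opposite fibre accumulates at it, and by
   [vclY] so does the interior of that fibre. *)
have bdY b x : (~` E) x -> closure (Y b) x.
  move=> nEx; have [->|bv] := eqVneq b (v x); first exact: vclY.
  have : (~` Y (v x)) x by move=> Yx; apply: nEx; case: (v x) Yx; [left | right].
  rewrite -closure_setC => xcl.
  have vYb : ~` [set y | v y = v x] `<=` closure (Y b).
    move=> y /= /eqP vy; have <- : v y = b; last exact: vclY.
    by move: vy bv; case: (v y); case: (v x); case: (b).
  by rewrite ((closure_id _).1 (@closed_closure _ (Y b))); exact: (closureS vYb).
have YYdisj : Y true `&` Y false = set0.
  by apply/seteqP; split => // x [/vY vx /vY]; rewrite vx.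
have oE : open E by exact: openU.
have denseE : closure E = [set: X].
  apply/seteqP; split => // x _; apply: closureS (vclY x).
  by case: (v x) => y; [left | right].
have [N [finN homoN Ncov]] := nowhere_dense_finite_exhaustion E oE denseE.
have [G [GP homoG Gcov]] := regular_open_exhaustion (Y true) (Y false) (oY true)
  (oY false) YYdisj (bdY true).
(* As [N n] is finite, agreement on it can be joined to any finite condition met by members of
   [A n]. *)
pose A' n := [set g : Qp X bool | A n g /\ forall x, N n x -> set_val g x = v x].
have /choice [K KP] k : exists K : nat -> set (Qp X bool),
    (forall n, finite_set (K n) /\ K n `<=` A' n) /\
    forall m F, finite_set F -> exists n g U, [/\ (m <= n)%N, K n g,
      forall x, closure U x -> (Y true `|` G k) x -> set_val g x = v x &
      F `<=` closure U].
  apply: (S_fin_KOmega_select A' (fun _ (g : Qp X bool) U =>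
    forall x, closure U x -> (Y true `|` G k) x -> set_val g x = v x)) => //.
  move=> n F finF; have [oG GY] := GP k.
  have /closure_QpP/(_ (F `|` N n) (fun x => [set v x])) := fA n.
  rewrite finite_setU => /(_ (conj finF (finN n))) [|g Ag gv].
    by move=> x _; exact: discrete_set1.
  (* [v] is locally constant on [E], hence continuous there, which puts [F] within [E] in the
     closure of [D]. *)
  pose D := [set y | v y = set_val g y]° `&` E.
  have FD : F `&` E `<=` closure D.
    move=> x [Fx Ex] B nB.
    have cv : {for x, continuous v}.
      move=> C /nbhs_singleton Cx.
      have Yx : Y (v x) x by case: Ex => /[dup] /vY ->.
      by apply: filterS Yx => y /= ->.
    have nE : nbhs x (B `&` E) by apply: filterI => //; exact: open_nbhs_nbhs.
    have [|y [Dy [By Ey]]] := @quasicontinuous_closure_interior X bool bool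
      v (set_val g) [set yz | yz.1 = yz.2] x cv (set_mem (valP g)) _ _ nE.
      exists ([set v x], [set v x]).
        rewrite (gv x (or_introl Fx)).
        by split; exact: discrete_set1.
      by move=> [p q] /= [-> ->].
    by exists y.
  have oD : open D by apply: openI => //; exact: open_interior.
  have [W [oW WD FW clW]] := open_Whyburn_shrink D (F `&` E) regX owX oD
    (finite_setIl _ finF) FD.
  have Wgv x : closure W x -> set_val g x = v x.
    by move=> /clW [[/interior_subset //]|[Fx _]]; apply: gv; left.
  (* The second piece reaches the points of [F] off [E]; its closure misses [Y true] and [G k], so
     agreement there rests on [W] alone. *)
  exists g, (W `|` Y false `&` ~` closure (G k)); split.
  - by split => // x Nx; apply: gv; right.
  - rewrite closureU => x [/Wgv //|xcl] [Yx|Gx].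
      have [y Yy [Y'y _]] := open_closure_meets _ _ _ (oY true) Yx xcl.
      by have : set0 y by rewrite -YYdisj.
    have [y Gy [_]] := open_closure_meets _ _ _ oG Gx xcl.
    by case; exact: subset_closure.
  - by apply: openU => //; apply: openI => //; exact/closed_openC/closed_closure.
  - rewrite closureU => x Fx.
    have [Ex|nEx] := pselect (E x); [by left; apply: FW | right].
    move=> B nB; have nG : ~ closure (G k) x.
      by move=> /GY Yx; apply: nEx; right.
    have nBG : nbhs x (B `&` ~` closure (G k)).
      apply: filterI => //; apply: open_nbhs_nbhs; split => //.
      exact/closed_openC/closed_closure.
    by have [y [Yy [By Gy]]] := bdY false x nEx _ nBG; exists y.
exists (fun n => \bigcup_(k in `I_n.+1) K k n); split => [n|].
  split; last by move=> g [k _ Kg]; have [/(_ n) [_ /(_ g Kg) []]] := KP k.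
  by apply: bigcup_finite => [|k _]; [exact: finite_II | have [/(_ n)[]] := KP k].
apply/closure_QpP => F V finF nV.
have [m FN] := Ncov F finF; have [k FG] := Gcov F finF.
(* [k <= n] makes [K k n] part of the union at stage [n]; [m <= n] gives agreement on [N m]. *)
have [KA /(_ (maxn k m) F finF) [n [g [U [mn Kg gv FU]]]]] := KP k.
have [kn {}mn] : (k <= n)%N /\ (m <= n)%N by apply/andP; rewrite -geq_max.
exists g; first by exists n => //; exists k.
move=> x Fx; have -> : set_val g x = v x; last exact: nbhs_singleton (nV x Fx).
have [[Yx|Yx]|nEx] := pselect (E x).
- by apply: gv; [exact: FU | left].
- by apply: gv; [exact: FU | right; exact: FG].
- by have [_ /(_ g Kg) [_]] := KA n; apply; apply: (homoN m n mn); exact: FN.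
Qed.
End Exhaustion.

(** * The cycle of implications *)

Theorem theorem4p3 (R : realType) (X : topologicalType)
  (X_T1 : accessible_space X) (X_reg : regular_space X)
  (X_unc : ~ countable [set: X]) (X_ow : open_Whyburn X) :
  [<-> S_fin (@OmegaS X) (@OmegaS X);
       S_fin (@KOmega X) (@KOmega X);
       forall z : Qp X R^o, (set_val z : X -> R) = (fun _ => 0) -> vet_omega_at z;
       forall f : Qp X R^o, continuous (set_val f : X -> R^o) -> vet_omega_at f;
       vet_omega (Qp X bool)].
Proof.
have vet0 : (forall z : Qp X R^o, (set_val z : X -> R) = (fun _ => 0) ->
    vet_omega_at z) -> S_fin (@KOmega X) (@KOmega X).
  move=> vetX; apply: S_fin_OmegaS_KOmega.
  (* Balls are strict, so radius [1] already excludes the value [1]. *)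
  apply: (@vet_omega_cst_S_fin_OmegaS X R^o 0 1 (ball (0 : R^o) 1)) => //.
    exact: nbhsx_ballx.
  by rewrite /ball /= sub0r normrN normr1 ltxx.
have cst_continuous_Qp (z : Qp X R^o) : (set_val z : X -> R) = (fun _ => 0) ->
    continuous (set_val z : X -> R^o).
  by move=> ->; exact: cst_continuous.
tfae.
- exact: S_fin_OmegaS_KOmega.
- move=> selX z /cst_continuous_Qp; exact: S_fin_KOmega_vet_continuous.
(* This implication and the next return to [S_fin KOmega KOmega] through [vet0]. *)
- by move=> /vet0 selX f; exact: S_fin_KOmega_vet_continuous.
- move=> vetX; apply: S_fin_KOmega_vet_bool => //.
  by apply: vet0 => z /cst_continuous_Qp; exact: vetX.
- move=> vetX; apply: (@vet_omega_cst_S_fin_OmegaS X bool true false [set true]) => //.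
Qed.
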